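(* Let $G=(V_1\cup V_2,E)$ be a bipartite graph. Then we have $h_1(B_0(\overline G))=h_1(\overline G^b)$. Moreover, if $G$ is $r$-regular, $n:=|V_1|=|V_2|$, and $\lambda_2$ denotes the second largest eigenvalue of the adjacency matrix $A_G$, then we have $$\widehat h(\overline G^b)=\frac n2\,\frac{\lambda_2}{\lambda_2+n-r}\ \le\ \tfrac12\varphi_H(\overline G)=\frac n2\,\frac{\lambda_2+r}{2n-r+\lambda_2},$$ with strict inequality precisely when $\lambda_2<r<n$, i.e., when $G$ is connected and $G\ne K_{n,n}$.
   Context: $\overline G$ is the complement of $G$ on vertex set $V=V_1\cup V_2$, and $\overline G^b=(V_1\cup V_2,(V_1\times V_2)\setminus E)$ is the bipartite complement of $G$. $K_{n,n}$ is the complete bipartite graph with $n$ vertices on each side. The extended bipartite double $B_0(K)$ of a graph $K=(V,E_K)$ is the bipartite graph with bipartition $V\cup V'$, where $V'=\{i':i\in V\}$ is a disjoint copy of $V$, whose edges are $\{i,j'\}$ and $\{j,i'\}$ for $\{i,j\}\in E_K$ and $\{i,i'\}$ for $i\in V$. For a bipartite graph $H=(W=W_1\cup W_2,F)$ with adjacency matrix $A_H$, let $C$ be the symmetric matrix indexed by $W$ with entries $\frac12$ at positions with indices on different sides of the bipartition and $0$ elsewhere, and define $$h_1(H)=\max\{\langle C,X\rangle: X\text{ real symmetric indexed by }W,\ X\succeq0,\ \mathrm{Tr}(X)=1,\ X_{ij}=0\text{ for }\{i,j\}\in F\},$$ $$\widehat h(H)=\min_{\lambda,t\in\mathbb R}\{\lambda:\lambda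 I+tA_H-C\succeq0\},$$ with $\langle X,Y\rangle=\mathrm{Tr}(XY)$. For a graph $K$ on $N$ vertices, $\varphi_H(K)=\frac N2\big(1-\frac{\mu_2}{\mu_N}\big)$, where $0=\mu_1\le\mu_2\le\dots\le\mu_N$ are the eigenvalues of the Laplacian matrix of $K$ (diagonal degree matrix minus adjacency matrix).
   Formalization: For G = K_{n,n} the quotients in the closed forms can be 0/0 (e.g. λ_2 = 0, r = n = 2); they are read there as 1, and μ_2/μ_N = 0/0 in φ_H of an edgeless graph (only G = K_{1,1}) is read as 0. In all other cases the formulas are as stated. *)

(* Defs.v *)
From mathcomp Require Export all_boot all_order all_algebra.
From mathcomp Require Export boolp classical_sets reals.

Set Implicit Arguments.
Unset Strict Implicit.
Unset Printing Implicit Defensive.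

Import Order.TTheory GRing.Theory Num.Theory.

Local Open Scope ring_scope.

(* A graph on T is a symmetric irreflexive relation; a bipartite graph with
   bipartition W1, W2 is given by its edge set F : W1 -> W2 -> bool and lives on
   the disjoint union W1 + W2. *)

Section Graphs.

Definition bip_rel (W1 W2 : finType) (F : W1 -> W2 -> bool) : rel (W1 + W2) :=
  fun x y => match x, y with
             | inl i, inr j => F i j
             | inr j, inl i => F i j
             | _, _ => false
             end.

Definition graph_compl (T : finType) (e : rel T) : rel T :=
  fun x y => (x != y) && ~~ e x y.

Definition bip_compl (W1 W2 : finType) (F : W1 -> W2 -> bool) :
  W1 -> W2 -> bool := fun i j => ~~ F i j.

Definition complete_bip (W1 W2 : finType) : W1 -> W2 -> bool :=
  fun _ _ => true.

(* [B0 e i j] says that i is adjacent to the copy j' of j. *)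
Definition B0 (T : finType) (e : rel T) : T -> T -> bool :=
  fun i j => (i == j) || e i j.

Definition degree (T : finType) (e : rel T) (x : T) : nat := #|[set y | e x y]|.

Definition regular (T : finType) (e : rel T) (r : nat) : Prop :=
  forall x : T, degree e x = r.

Definition connected (T : finType) (e : rel T) : Prop :=
  forall x y : T, connect e x y.

End Graphs.

Section Matrices.

Variable R : realType.

(* Matrices indexed by a finite type T are matrices indexed by 'I_#|T| through
   [enum_rank] and [enum_val]. *)

Definition adj_mx (T : finType) (e : rel T) : 'M[R]_#|T| :=
  \matrix_(i, j) (e (enum_val i) (enum_val j))%:R.

Definition laplacian_mx (T : finType) (e : rel T) : 'M[R]_#|T| :=
  diag_mx (\row_i (degree e (enum_val i))%:R) - adj_mx e.

Definition psd m (X : 'M[R]_m) : Prop :=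
  X^T = X /\ forall u : 'rV[R]_m, 0 <= (u *m X *m u^T) 0 0.

(* The eigenvalues of A with multiplicity, in nondecreasing order: the unique
   sorted list of roots splitting the characteristic polynomial.  It exists for
   every symmetric A; the default value [::] is only met when the characteristic
   polynomial does not split over R. *)
Definition eigenvalues m (A : 'M[R]_m) : seq R :=
  xget [::] [set s : seq R | sorted <=%R s /\
                             char_poly A = \prod_(x <- s) ('X - x%:P)].

Definition second_largest_eigenvalue m (A : 'M[R]_m) : R :=
  (rev (eigenvalues A))`_1.

End Matrices.

Section Bounds.

Variable R : realType.

Definition C_mx (W1 W2 : finType) : 'M[R]_#|{: W1 + W2}| :=
  2^-1 *: adj_mx R (bip_rel (@complete_bip W1 W2)).

Definition h1_feasible (W1 W2 : finType) (F : W1 -> W2 -> bool)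
    (X : 'M[R]_#|{: W1 + W2}|) : Prop :=
  [/\ psd X, \tr X = 1 &
      forall x y : W1 + W2, bip_rel F x y -> X (enum_rank x) (enum_rank y) = 0].

Definition h1_values (W1 W2 : finType) (F : W1 -> W2 -> bool) : set R :=
  [set \tr (C_mx W1 W2 *m X) | X in [set X | h1_feasible F X]].

Definition h1 (W1 W2 : finType) (F : W1 -> W2 -> bool) : R :=
  sup (h1_values F).

Definition hhat_values (W1 W2 : finType) (F : W1 -> W2 -> bool) : set R :=
  [set l | exists t : R,
     psd (l%:M + t *: adj_mx R (bip_rel F) - C_mx W1 W2)].

Definition hhat (W1 W2 : finType) (F : W1 -> W2 -> bool) : R :=
  inf (hhat_values F).

(* For an edgeless graph mu_2 / mu_N is 0 / 0, which is 0 here, so that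
   phi_H is N / 2. *)
Definition phiH (T : finType) (e : rel T) : R :=
  let mu := eigenvalues (laplacian_mx R e) in
  #|T|%:R / 2 * (1 - mu`_1 / mu`_(#|T|.-1)).

(* Quotient with 0 / 0 = 1.  The closed form lambda_2 / (lambda_2 + n - r)
   is 0 / 0 for K_{n,n}, n >= 2, and (lambda_2 + r) / (2n - r + lambda_2) is
   0 / 0 for K_{1,1}; in both cases the value 1 is the one for which the closed
   form gives the parameter. *)
Definition quot (a b : R) : R :=
  if (a == 0) && (b == 0) then 1 else a / b.

End Bounds.

(* On a nonempty vertex set the sup and the inf defining [h1] and [hhat] are a
   max and a min: lemmas [h1_max] and [hhat_min]. *)

From mathcomp Require Import functions topology normedtype derive.
From mathcomp Require Import ring lra.

Import numFieldTopology.Exports numFieldNormedType.Exports.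

Section LinearPrograms.

Local Open Scope classical_set_scope.

Variable R : realType.

Lemma linear_rV_continuous k (f : 'rV[R]_k -> R) :
  (forall a u v, f (a *: u + v) = a * f u + f v) -> continuous f.
Proof.
move=> fL.
have f0 : f 0 = 0.
  by have := fL 1 0 0; rewrite scaler0 addr0 mul1r => /eqP; rewrite -subr_eq0; lra.
have fE : f = fun v => \sum_j v 0 j * f (delta_mx 0 j).
  apply/funext => v; rewrite {1}(row_sum_delta v).
  elim/big_ind2 : _ => // [x1 x2 y1 y2 Hx Hy|i _]; last first.
    by have := fL (v 0 i) (delta_mx 0 i) 0; rewrite !addr0 f0 addr0.
  by have := fL 1 x2 y2; rewrite scale1r mul1r Hx Hy.
rewrite fE; apply: continuous_big => [|j _ x].
  exact: add_continuous.
apply: (@cvgM _ _ (nbhs x) _ (fun v : 'rV[R]_k => v 0 j) (fun=> f (delta_mx 0 j))).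
  2: exact: cvg_cst.
exact: (@coord_continuous R 1 k 0 j x).
Qed.

Lemma linear_closed_ge k (f : 'rV[R]_k -> R) b :
  (forall a u v, f (a *: u + v) = a * f u + f v) -> closed [set v | b <= f v].
Proof.
move=> fL; apply: (@preimage_closed _ _ f [set y | b <= y]).
  by move=> x _; exact: linear_rV_continuous.
exact: closed_ge.
Qed.

Lemma linear_max k (I : Type) (f : I -> 'rV[R]_k -> R) (b : I -> R)
    (g : 'rV[R]_k -> R) (M : R) :
  0 <= M ->
  (forall i a u v, f i (a *: u + v) = a * f i u + f i v) ->
  (forall a u v, g (a *: u + v) = a * g u + g v) ->
  (exists v, forall i, b i <= f i v) ->
  (forall v, (forall i, b i <= f i v) -> forall j, `|v 0 j| <= M) ->
  exists2 v, forall i, b i <= f i v &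
    forall w, (forall i, b i <= f i w) -> g w <= g v.
Proof.
move=> M0 fL gL [v0 v0P] bM.
pose A := \bigcap_(i in [set: I]) [set v | b i <= f i v].
have AP v : A v <-> forall i, b i <= f i v.
  by split=> [Av i|Av i _]; [exact: Av|exact: Av].
have cA : compact A.
  apply: bounded_closed_compact; last first.
    by apply: closed_bigI => i _; exact: linear_closed_ge.
  exists M; split; first exact: num_real.
  move=> x Mx v /AP /bM vM /=.
  rewrite [leLHS]/Num.norm /= mx_normrE.
  apply/bigmax_leP; split=> [|[i j] _ /=]; last first.
    by rewrite (ord1 i) (le_trans (vM j))// ltW.
  exact: le_trans M0 (ltW Mx).
have A0 : A !=set0 by exists v0; apply/AP.
have gc : {within A, continuous g}.
  by apply: continuous_subspaceT; exact: linear_rV_continuous.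
have [v vA vmax] := EVT_max_rV A0 cA gc.
exists v; first by apply/AP/set_mem.
by move=> w /AP wA; apply: vmax; exact/mem_set.
Qed.
End LinearPrograms.

Section Attainment.

Variable R : realType.

Lemma qformE m (X : 'M[R]_m) (u : 'rV[R]_m) :
  (u *m X *m u^T) 0 0 = \sum_i \sum_j u 0 i * X i j * u 0 j.
Proof.
rewrite mxE exchange_big; apply: eq_bigr => j _ /=.
by rewrite !mxE mulr_suml.
Qed.

Lemma qform_delta2 m (X : 'M[R]_m) (i j : 'I_m) (a : R) :
  let u := delta_mx 0 i + a *: delta_mx 0 j : 'rV[R]_m in
  (u *m X *m u^T) 0 0 = X i i + a * (X i j + X j i) + a ^+ 2 * X j j.
Proof.
move=> u; rewrite /u linearD/= linearZ/= !trmx_delta !mulmxDl !mulmxDr.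
rewrite -!scalemxAl -!scalemxAr -!rowE.
rewrite -!colE !mxE; ring.
Qed.

Lemma adj_mx_sym (T : finType) (e : rel T) :
  symmetric e -> (adj_mx R e)^T = adj_mx R e.
Proof. by move=> es; apply/matrixP => i j; rewrite !mxE es. Qed.

Lemma bip_rel_sym (W1 W2 : finType) (F : W1 -> W2 -> bool) :
  symmetric (bip_rel F).
Proof. by case=> [x|x] [y|y]. Qed.

Lemma psd_diag m (X : 'M[R]_m) i : psd X -> 0 <= X i i.
Proof.
move=> [_ /(_ (delta_mx 0 i + 0 *: delta_mx 0 i))].
by rewrite qform_delta2; lra.
Qed.

Lemma psd_entry m (X : 'M[R]_m) i j : psd X -> `|X i j| <= (X i i + X j j) / 2.
Proof.
move=> [Xs Xp].
have Xij : X j i = X i j by rewrite -{1}Xs mxE.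
have := Xp (delta_mx 0 i + 1 *: delta_mx 0 j).
have := Xp (delta_mx 0 i + (-1) *: delta_mx 0 j).
rewrite !qform_delta2 Xij ler_norml => H1 H2; apply/andP; split; lra.
Qed.

Lemma qform_linear m (a : R) (X Y : 'M[R]_m) (u : 'rV[R]_m) :
  (u *m (a *: X + Y) *m u^T) 0 0
    = a * (u *m X *m u^T) 0 0 + (u *m Y *m u^T) 0 0.
Proof. by rewrite mulmxDr mulmxDl -scalemxAr -scalemxAl !mxE. Qed.

Lemma qform_pencil m (A C : 'M[R]_m) (l t : R) (u : 'rV[R]_m) :
  (u *m (l%:M + t *: A - C) *m u^T) 0 0
    = l * (u *m u^T) 0 0 + t * (u *m A *m u^T) 0 0 - (u *m C *m u^T) 0 0.
Proof.
rewrite -addrA -scalemx1 qform_linear mulmx1 qform_linear.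
by rewrite mulmxN mulNmx [X in _ + (_ + X)]mxE addrA.
Qed.

Lemma h1_max (W1 W2 : finType) (F : W1 -> W2 -> bool) :
  (0 < #|{: W1 + W2}|)%N ->
  h1_values F (h1 R F) /\ ubound (h1_values F) (h1 R F).
Proof.
set m := #|_|; move=> m_gt0.
pose L (X : 'M[R]_m) := \tr (C_mx R W1 W2 *m X).
pose I : Type := 'rV[R]_m + bool + ('I_m * 'I_m)
  + bool * {p : (W1 + W2) * (W1 + W2) | bip_rel F p.1 p.2}.
pose f (i : I) (v : 'rV[R]_(m * m)) : R := match i with
  | inl (inl (inl u)) => (u *m vec_mx v *m u^T) 0 0
  | inl (inl (inr s)) => (-1) ^+ s * \tr (vec_mx v)
  | inl (inr (i, j)) => vec_mx v i j - vec_mx v j i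
  | inr (s, p) => (-1) ^+ s * vec_mx v (enum_rank (sval p).1) (enum_rank (sval p).2)
  end.
pose b (i : I) : R := match i with inl (inl (inr s)) => (-1) ^+ s | _ => 0 end.
have fP v : (forall i, b i <= f i v) <-> h1_feasible F (vec_mx v).
  split=> [H|[[Xs Xp] Xt X0]]; last first.
    case=> [[[u|s]|[i j]]|[s [[x y] /= xy]]] /=.
    - exact: Xp.
    - by rewrite Xt mulr1.
    - by rewrite -{1}Xs mxE subrr.
    - by rewrite X0// mulr0.
  split; first split.
  - apply/matrixP => i j; rewrite mxE.
    have := H (inl (inr (i, j))); have := H (inl (inr (j, i))); rewrite /f /b.
    by move=> H1 H2; apply/eqP; rewrite eq_le; apply/andP; split; lra.
  - by move=> u; exact: (H (inl (inl (inl u)))).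
  - have := H (inl (inl (inr true))); have := H (inl (inl (inr false))).
    rewrite /f /b expr0 expr1 => H1 H2.
    by apply/eqP; rewrite eq_le; apply/andP; split; lra.
  - move=> x y xy.
    have := H (inr (true, exist _ (x, y) xy)).
    have := H (inr (false, exist _ (x, y) xy)).
    rewrite /f /b /= expr0 expr1 => H1 H2.
    by apply/eqP; rewrite eq_le; apply/andP; split; lra.
have [|||||v /fP vP vmax] :=
  @linear_max R (m * m)%N I f b (fun v => L (vec_mx v)) 1.
- exact: ler01.
- case=> [[[u|s]|[i j]]|[s p]] a v w /=; rewrite linearP /=.
  + exact: qform_linear.
  + by rewrite linearP/=; ring.
  + by rewrite !mxE; ring.
  + by rewrite !mxE; ring.
- by move=> a v w; rewrite /L linearP /= mulmxDr -scalemxAr linearP.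
- exists (mxvec (delta_mx (Ordinal m_gt0) (Ordinal m_gt0))).
  apply/fP; rewrite mxvecK; split; first split.
  + by rewrite trmx_delta.
  + move=> u; rewrite qformE; apply: sumr_ge0 => i _; apply: sumr_ge0 => j _.
    rewrite mxE; case: eqP => [->|_]; case: eqP => [->|_] /=;
      by rewrite ?mulr1 ?mulr0 ?mul0r// -expr2 sqr_ge0.
  + rewrite /mxtrace (bigD1 (Ordinal m_gt0))//= big1 ?addr0 ?mxE ?eqxx// => i.
    by rewrite mxE => /negPf ->.
  + move=> x y xy; rewrite mxE.
    case: eqP => //= xE; case: eqP => //= yE; move: xy.
    have -> : x = y by apply: enum_rank_inj; rewrite xE yE.
    by case: (y).
- move=> v /fP [Xp Xt _] j; rewrite -[v]vec_mxK.
  case/mxvec_indexP: j => i j; rewrite mxvecE.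
  have le1 k : vec_mx v k k <= 1.
    rewrite -Xt /mxtrace (bigD1 k)//= lerDl; apply: sumr_ge0 => l _.
    exact: psd_diag.
  by apply: (le_trans (psd_entry _ _ Xp)); have := le1 i; have := le1 j; lra.
have ub : ubound (h1_values F) (L (vec_mx v)).
  move=> _ [X XF <-]; have := vmax (mxvec X); rewrite mxvecK; apply.
  by apply/fP; rewrite mxvecK.
have vin : h1_values F (L (vec_mx v)) by exists (vec_mx v).
have hE : h1 R F = L (vec_mx v).
  apply/eqP; rewrite eq_le; apply/andP; split.
    by apply: ge_sup => //; exists (L (vec_mx v)).
  by apply: ub_le_sup => //; exists (L (vec_mx v)).
by rewrite hE; split=> // w; exact: ub.
Qed.

Lemma hhat_min (W1 W2 : finType) (F : W1 -> W2 -> bool) :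
  (0 < #|{: W1 + W2}|)%N ->
  hhat_values F (hhat R F) /\ lbound (hhat_values F) (hhat R F).
Proof.
set m := #|_|; move=> m_gt0.
pose A : 'M[R]_m := adj_mx R (bip_rel F).
pose C : 'M[R]_m := C_mx R W1 W2.
have Cs : C^T = C by rewrite /C /C_mx linearZ /= adj_mx_sym//; exact: bip_rel_sym.
have As : A^T = A by apply: adj_mx_sym; exact: bip_rel_sym.
pose hv l t := psd (l%:M + t *: A - C).
have hvP l t : hv l t <-> forall u : 'rV[R]_m,
    (u *m C *m u^T) 0 0 <= l * (u *m u^T) 0 0 + t * (u *m A *m u^T) 0 0.
  have E (u : 'rV[R]_m) : (u *m (l%:M + t *: A - C) *m u^T) 0 0 =
      l * (u *m u^T) 0 0 + t * (u *m A *m u^T) 0 0 - (u *m C *m u^T) 0 0.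
    exact: qform_pencil.
  split=> [[_ H] u|H]; first by have := H u; rewrite E subr_ge0.
  split=> [|u]; last by rewrite E subr_ge0.
  by rewrite !linearB !linearD /= linearZ /= tr_scalar_mx As Cs.
have C1 i j : 0 <= C i j <= 1.
  by rewrite !mxE; case: bip_rel; rewrite /= ?mulr1 ?mulr0; apply/andP; split; lra.
have diag0 (G : W1 -> W2 -> bool) i : adj_mx R (bip_rel G) i i = 0.
  by rewrite mxE; case: enum_val.
have C0 i : C i i = 0 by rewrite mxE diag0 mulr0.
have Xd l t i : (l%:M + t *: A - C) i i = l.
  have -> : (l%:M + t *: A - C) i i = (l%:M : 'M[R]_m) i i + t * A i i - C i i.
    by rewrite !mxE.
  by rewrite C0 [A i i]diag0 mxE eqxx mulr1n; ring.
have hv_ge0 l t : hv l t -> 0 <= l.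
  by move=> /(psd_diag (Ordinal m_gt0)); rewrite Xd.
have hv0 : hv m%:R 0.
  apply/hvP => u; rewrite mul0r addr0.
  have -> : m%:R * (u *m u^T) 0 0
      = \sum_i \sum_j (u 0 i ^+ 2 + u 0 j ^+ 2) / 2.
    have -> : (u *m u^T) 0 0 = \sum_i u 0 i ^+ 2.
      by rewrite mxE; apply: eq_bigr => i _; rewrite mxE expr2.
    have S1 : \sum_(i < m) \sum_(j < m) u 0 i ^+ 2 / 2
        = m%:R * (\sum_i u 0 i ^+ 2) / 2.
      under eq_bigr do rewrite sumr_const card_ord.
      by rewrite sumrMnl -mulr_suml -[LHS]mulr_natl mulrA.
    rewrite [RHS](eq_bigr (fun i => \sum_(j < m) u 0 i ^+ 2 / 2
                             + \sum_(j < m) u 0 j ^+ 2 / 2)); last first.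
      move=> i _; rewrite -big_split /=; apply: eq_bigr => j _.
      by rewrite mulrDl.
    by rewrite big_split /= [X in _ + X]exchange_big /= S1; field.
  rewrite qformE; apply: ler_sum => i _; apply: ler_sum => j _.
  have /andP[c0 c1] := C1 i j.
  have [] := (sqr_ge0 (u 0 i - u 0 j), sqr_ge0 (u 0 i + u 0 j)).
  nra.
pose z : R := if [exists p : W1 * W2, F p.1 p.2] then 0 else 1.
pose I : Type := 'rV[R]_m + unit + bool.
pose L (v : 'rV[R]_2) : R := v 0 0.
pose T (v : 'rV[R]_2) : R := v 0 1.
pose f (i : I) (v : 'rV[R]_2) : R := match i with
  | inl (inl u) => L v * (u *m u^T) 0 0 + T v * (u *m A *m u^T) 0 0
  | inl (inr _) => - L v
  | inr s => (-1) ^+ s * (z * T v)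
  end.
pose b (i : I) : R := match i with
  | inl (inl u) => (u *m C *m u^T) 0 0 | inl (inr _) => - m%:R | inr _ => 0 end.
have fP v : (forall i, b i <= f i v) <->
    [/\ hv (L v) (T v), L v <= m%:R & z * T v = 0].
  split=> [H|[/hvP H1 H2 H3]]; last first.
    by case=> [[u|_]|s] /=; rewrite ?lerN2 ?H3 ?mulr0.
  split; first by apply/hvP => u; exact: (H (inl (inl u))).
  - by have := H (inl (inr tt)); rewrite /f /b lerN2.
  - have := H (inr true); have := H (inr false).
    rewrite /f /b expr0 expr1 => H1 H2.
    by apply/eqP; rewrite eq_le; apply/andP; split; lra.
have [|||||v /fP [vP vm _] vmax] := @linear_max R 2 I f b (fun v => - L v) (m%:R + 1).
- by have : 0 <= m%:R :> R by []; lra.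
- case=> [[u|[]]|s] a v w; rewrite /f /L /T !mxE; ring.
- by move=> a v w; rewrite /L !mxE; ring.
- exists (m%:R *: delta_mx 0 0); apply/fP.
  by rewrite /L /T !mxE /= mulr1 !mulr0; split.
- move=> v /fP [vP vm vz] j.
  have L0 := hv_ge0 _ _ vP.
  have Tb : `|T v| <= m%:R + 1.
    move: vz; rewrite /z; case: existsP => [[[x y] /= xy] _|_]; last first.
      by rewrite mul1r => ->; rewrite normr0; have : 0 <= m%:R :> R by []; lra.
    have := psd_entry (enum_rank (inl x : W1 + W2)%type) (enum_rank (inr y : W1 + W2)%type) vP.
    have -> : (((L v)%:M + T v *: A - C) : 'M[R]_m)
        (enum_rank (inl x : W1 + W2)%type) (enum_rank (inr y : W1 + W2)%type)
        = T v - 2^-1.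
      by rewrite !mxE !enum_rankK /= xy (inj_eq enum_rank_inj) /= mulr0n; ring.
    rewrite !Xd !ler_norml => /andP[t1 t2].
    by apply/andP; split; lra.
  have Lb : `|L v| <= m%:R + 1 by rewrite ger0_norm//; lra.
  have [->|->] : j = 0 \/ j = 1.
    by case: j => [[|[|//]] ?]; [left|right]; exact: val_inj.
  + exact: Lb.
  + exact: Tb.
have vin : hhat_values F (L v) by exists (T v).
have lb : lbound (hhat_values F) (L v).
  move=> l [t lt].
  have [lm|ml] := leP l m%:R; last exact: le_trans vm (ltW ml).
  pose t' := if z == 0 then t else 0.
  have ht' : hv l t' /\ z * t' = 0.
    rewrite /t'; have [->|z0] := eqVneq z 0; first by rewrite mul0r.
    rewrite mulr0; split=> //.
    have A0 : A = 0.
      apply/matrixP => i j; rewrite !mxE.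
      move: z0; rewrite /z; case: existsP => [|noE _]; first by rewrite eqxx.
      case: (enum_val i) => x; case: (enum_val j) => y //=;
        case Exy : (F _ _) => //; exfalso; apply: noE.
      - by exists (x, y).
      - by exists (y, x).
    by move: lt; rewrite -/A A0 /hv A0 !scaler0.
  have := vmax (l *: delta_mx 0 0 + t' *: delta_mx 0 1).
  rewrite lerN2 {2}/L !mxE /= mulr1 mulr0 addr0; apply.
  by apply/fP; rewrite /L /T !mxE /= !mulr1 !mulr0 addr0 add0r; case: ht'.
have hE : hhat R F = L v.
  apply/eqP; rewrite eq_le; apply/andP; split.
    by apply: ge_inf => //; exists (L v).
  by apply: lb_le_inf => //; exists (L v).
by rewrite hE; split=> // w; exact: lb.
Qed.
End Attainment.

(* Main.v *)
From mathcomp Require Import topology normedtype derive.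
From mathcomp Require Import ring lra.
Require Import Defs.
Import Order.TTheory GRing.Theory Num.Theory.
Import numFieldTopology.Exports numFieldNormedType.Exports.
Local Open Scope ring_scope.

Set Implicit Arguments.
Unset Strict Implicit.
Unset Printing Implicit Defensive.

(** The equality of the two values of h_1 holds because the bipartite complement
    of B_0 of the complement of G is a disjoint union of two copies of G: one on
    V_1 and V_2', one on V_2 and V_1'.  A feasible matrix for G^b extends by zero
    from one copy, and a feasible matrix on the double restricts to both copies,
    where the sum of the two restrictions is feasible with the same objective
    ([h1_values_double]).  So the two sets of objective values agree.

    For the second part let A be the adjacency matrix of G, m = 2n its size, 1
    the all-ones vector and s the vector that is 1 on V_1 and -1 on V_2.
    Regularity makes 1 and s eigenvectors of A, with eigenvalues r and -r, and
    all the matrices of the problem are combinations of I, A, 1^T 1 and s^T s: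
    - C = (1^T 1 - s^T s) / 4,
    - the adjacency matrix of the bipartite complement is 2 C - A,
    - the Laplacian of the complement is (2n - r) I - 1^T 1 + A.
    Hence one orthonormal eigenbasis of A that starts with the directions of 1
    and s ([bip_eigenbasis_exists]) diagonalizes all of them.  Write
    d_0 = r, d_1 = -r, d_2, ... for the eigenvalues of A in this basis.  They lie
    in [-r, r] ([d_bound]), so lambda_2 is the largest of the d_i with i >= 1.

    The matrix l I + t (2 C - A) - C is positive semidefinite iff l is an upper
    bound of n/2 - t (n - r), of its opposite, and of all t d_i with i >= 2.  The
    trace of A vanishes, so the d_i with i >= 2 sum to 0 and, when there are any,
    their maximum lambda_2 is nonnegative.  The smallest l is then reached where
    n/2 - t (n - r) = t lambda_2, or is n/2 if lambda_2 = 0 and r = n, which gives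
    [hhat_closed_form]; for n = 1 there is no such d_i, and 0 takes the place of
    lambda_2 = -r.  The Laplacian
    has eigenvalues 0 and 2n - r + d_i for i >= 1, hence
    mu_2 = 2 (n - r), from s, and mu_N = 2n - r + lambda_2
    ([phiH_closed_form]).  For n >= 2 the difference of the two closed forms
    has the sign of (n - r) (r - lambda_2) ([quot_compare]).

    Finally lambda_2 = r iff r has an eigenvector orthogonal to 1.  Since
    r |u|^2 - u A u is the sum of (u_x - u_y)^2 over the edges xy, the
    eigenvectors for r are the functions constant on components, and one of them
    is orthogonal to 1 exactly when there are at least two components
    ([lambda2_lt_connected]). *)

(** * Orthonormal eigenbases of real symmetric matrices *)

Section Dot.

Variables (R : realType) (m : nat).
Implicit Types (u v w : 'rV[R]_m) (A : 'M[R]_m) (a : R).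

Definition dot u v : R := (u *m v^T) 0 0.

Lemma dotE u v : dot u v = \sum_k u 0 k * v 0 k.
Proof. by rewrite /dot mxE; apply: eq_bigr => k _; rewrite mxE. Qed.

Lemma dotC u v : dot u v = dot v u.
Proof. by rewrite !dotE; apply: eq_bigr => k _; rewrite mulrC. Qed.

Lemma dotDl u v w : dot (u + v) w = dot u w + dot v w.
Proof. by rewrite /dot mulmxDl mxE. Qed.

Lemma dotZl a u w : dot (a *: u) w = a * dot u w.
Proof. by rewrite /dot -scalemxAl mxE. Qed.

Lemma dotDr u v w : dot w (u + v) = dot w u + dot w v.
Proof. by rewrite dotC dotDl ![dot _ w]dotC. Qed.

Lemma dotZr a u w : dot w (a *: u) = a * dot w u.
Proof. by rewrite dotC dotZl dotC. Qed.

Lemma dot_ge0 u : 0 <= dot u u.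
Proof. by rewrite dotE; apply: sumr_ge0 => k _; rewrite -expr2 sqr_ge0. Qed.

Lemma dot_eq0 u : (dot u u == 0) = (u == 0).
Proof.
rewrite dotE psumr_eq0 => [|k _]; last by rewrite -expr2 sqr_ge0.
apply/allP/eqP => [u0|-> k _]; last by rewrite /= mxE mulr0 eqxx.
apply/rowP => k; rewrite mxE; apply/eqP.
by have := u0 k; rewrite mem_index_enum -expr2 sqrf_eq0 => /(_ isT).
Qed.

Lemma dot_mulmx_sym A u v : A^T = A -> dot (u *m A) v = dot u (v *m A).
Proof. by move=> As; rewrite /dot trmx_mul As mulmxA. Qed.

Lemma qform_continuous A : continuous (fun u => dot (u *m A) u).
Proof.
rewrite (_ : (fun u => _) = fun u => \sum_k (u *m A) 0 k * u 0 k); last first.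
  by apply/funext => u; rewrite dotE.
apply: continuous_big => [|k _ x]; first exact: add_continuous.
apply: (@cvgM _ _ (nbhs x) _ (fun u => (u *m A) 0 k) (fun u => u 0 k)).
  apply: (@linear_rV_continuous _ _ (fun u => (u *m A) 0 k)).
  by move=> a u v; rewrite mulmxDl -scalemxAl !mxE.
exact: (@coord_continuous R 1 m 0 k x).
Qed.

End Dot.

Section EigenExtension.

Local Open Scope classical_set_scope.

Variables (R : realType) (m : nat).
Implicit Types (u v w : 'rV[R]_m) (A : 'M[R]_m).

Lemma exists_unit_orthogonal k (e : nat -> 'rV[R]_m) : (k < m)%N ->
  exists2 u, dot u u = 1 & forall i, (i < k)%N -> dot (e i) u = 0.
Proof.
move=> km; pose K : 'M[R]_(k, m) := \matrix_(i < k) e i.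
have : kermx K^T != 0.
  rewrite -mxrank_eq0 mxrank_ker -lt0n subn_gt0.
  exact: leq_ltn_trans (rank_leq_col _) km.
case/rowV0Pn => v /sub_kermxP vK v0.
have vv : 0 < dot v v by rewrite lt_def dot_eq0 v0 dot_ge0.
exists ((Num.sqrt (dot v v))^-1 *: v).
  rewrite dotZl dotZr mulrA -invfM -expr2 sqr_sqrtr ?dot_ge0//.
  by rewrite mulVf// gt_eqF.
move=> i ik; rewrite dotZr dotC /dot.
have -> : (v *m (e i)^T) 0 0 = (v *m K^T) 0 (Ordinal ik).
  by rewrite !mxE; apply: eq_bigr => j _; rewrite !mxE.
by rewrite vK [X in _ * X]mxE mulr0.
Qed.

(** Maximizing the Rayleigh quotient over the unit vectors orthogonal to given
    eigenvectors produces a further eigenvector: A preserves the orthogonal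
    complement of the eigenvectors, so the gradient at the maximum lies in that
    complement, where stationarity kills it. *)
Lemma exists_eigenvector_orthogonal A k (e : nat -> 'rV[R]_m) (d : nat -> R) :
  A^T = A -> (k < m)%N ->
  (forall i, (i < k)%N -> e i *m A = d i *: e i) ->
  exists u mu, [/\ dot u u = 1, forall i, (i < k)%N -> dot (e i) u = 0 &
                   u *m A = mu *: u].
Proof.
move=> As km eA.
pose f u := dot (u *m A) u.
pose S : set 'rV[R]_m :=
  [set u | dot (u *m 1%:M) u = 1] `&`
  \bigcap_(i in [set i | (i < k)%N]) [set u | dot (e i) u = 0].
have SP u : S u <-> dot u u = 1 /\ forall i, (i < k)%N -> dot (e i) u = 0.
  by rewrite /S /= mulmx1; split.
have S0 : S !=set0.
  by have [u uu ue] := exists_unit_orthogonal e km; exists u; apply/SP.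
have cS : compact S.
  apply: bounded_closed_compact.
    exists 1; split; first exact: num_real.
    move=> x x1 v /SP[vv _] /=.
    rewrite [leLHS]/Num.norm /= mx_normrE.
    apply/bigmax_leP; split=> [|[i j] _ /=]; first by rewrite ltW// (le_lt_trans _ x1).
    rewrite (ord1 i) (le_trans _ (ltW x1))// -(@ler_pXn2r _ 2)// ?nnegrE//.
    rewrite expr1n real_normK ?num_real// -vv dotE (bigD1 j)//= -expr2 lerDl.
    by apply: sumr_ge0 => l _; rewrite -expr2 sqr_ge0.
  apply: closedI.
    apply: (@preimage_closed _ _ (fun u => dot (u *m 1%:M) u) [set y | y = 1]).
      by move=> x _; exact: qform_continuous.
    exact: closed_eq.
  apply: closed_bigI => i _.
  apply: (@preimage_closed _ _ (fun u => dot (e i) u) [set y | y = 0]).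
    move=> x _; apply: linear_rV_continuous => a u v.
    by rewrite dotDr dotZr.
  exact: closed_eq.
have fc : {within S, continuous f}.
  by apply: continuous_subspaceT; exact: qform_continuous.
have [u /set_mem/SP[uu ue] umax] := EVT_max_rV S0 cS fc.
exists u, (f u); split=> //.
set mu := f u.
have fmu w : (forall i, (i < k)%N -> dot (e i) w = 0) -> f w <= mu * dot w w.
  move=> we; have [->|w0] := eqVneq w 0.
    by rewrite /f mul0mx /dot mul0mx mxE mulr0.
  have ww : 0 < dot w w by rewrite lt_def dot_eq0 w0 dot_ge0.
  pose c := (Num.sqrt (dot w w))^-1.
  have cc : c * c = (dot w w)^-1.
    by rewrite /c -invfM -expr2 sqr_sqrtr ?dot_ge0.
  have /umax : c *: w \in S.
    apply/mem_set/SP; split=> [|i ik]; last by rewrite dotZr we// mulr0.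
    by rewrite dotZl dotZr mulrA cc mulVf// gt_eqF.
  rewrite /f -scalemxAl dotZl dotZr mulrA cc -/(f w) -/(f u) -/mu.
  by rewrite -ler_pdivrMr// mulrC.
have [v vE] : exists v, v = mu *: u - u *m A by exists (mu *: u - u *m A).
have ve i : (i < k)%N -> dot (e i) v = 0.
  move=> ik; rewrite vE -scaleN1r dotDr !dotZr ue// -dot_mulmx_sym// eA//.
  by rewrite dotZl ue//; ring.
have uAv : dot (u *m A) v = mu * dot u v - dot v v.
  have -> : dot v v = mu * dot u v - dot (u *m A) v.
    by rewrite {1}vE -scaleN1r dotDl !dotZl; ring.
  by ring.
(* The form mu |w|^2 - w A w is nonnegative on the orthogonal complement and
   vanishes at u, so it is stationary there, and half its gradient is v. *)
have stat a : 0 <= 2 * a * dot v v + a ^+ 2 * (mu * dot v v - f v).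
  have we i : (i < k)%N -> dot (e i) (u + a *: v) = 0.
    by move=> ik; rewrite dotDr dotZr ue// ve// mulr0 addr0.
  have := fmu _ we.
  have -> : f (u + a *: v)
      = mu + 2 * a * (mu * dot u v - dot v v) + a ^+ 2 * f v.
    rewrite /f mulmxDl -scalemxAl !dotDl !dotDr !dotZl !dotZr.
    rewrite (dot_mulmx_sym v u As) (dotC v (u *m A)) uAv -/(f u) -/(f v) -/mu.
    by ring.
  rewrite !dotDl !dotDr !dotZl !dotZr uu (dotC v u); lra.
have q0 : 0 <= mu * dot v v - f v by rewrite subr_ge0; exact: fmu.
suff : dot v v = 0 by move/eqP; rewrite dot_eq0 vE subr_eq0 => /eqP.
move: (dot_ge0 v) stat q0; set s := dot v v; set c := _ - _ => s0 stat q0.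
apply/eqP; rewrite eq_le s0 andbT leNgt; apply/negP => sp.
have := stat (- s / (c + 1)).
have -> : 2 * (- s / (c + 1)) * s + (- s / (c + 1)) ^+ 2 * c
   = - ((s / (c + 1)) ^+ 2 * (c + 2)) by field; rewrite gt_eqF//; lra.
rewrite oppr_ge0 leNgt mulr_gt0// ?exprn_gt0// ?divr_gt0//; lra.
Qed.

(** A finite family of vectors is encoded by a function on [nat], of which only the
    first k values matter, so that vectors can be appended one at a time without
    changing the type of the index. *)
Definition orthonormal (k : nat) (e : nat -> 'rV[R]_m) : Prop :=
  forall i j, (i < k)%N -> (j < k)%N -> dot (e i) (e j) = (i == j)%:R.

(** The spectral theorem in a form that lets the first basis vectors be
    prescribed, which is what makes several matrices diagonal at once. *)
Lemma orthonormal_eigen_extend A k (e : nat -> 'rV[R]_m) (d : nat -> R) :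
  A^T = A -> (k <= m)%N -> orthonormal k e ->
  (forall i, (i < k)%N -> e i *m A = d i *: e i) ->
  exists e' d', [/\ orthonormal m e',
                    forall i, (i < m)%N -> e' i *m A = d' i *: e' i &
                    forall i, (i < k)%N -> e' i = e i /\ d' i = d i].
Proof.
move=> As; move: {2}(m - k)%N (erefl (m - k)%N) => l.
elim: l k e d => [|l IH] k e d mk km eo eA.
  have km_eq : k = m by apply/eqP; rewrite eqn_leq km -subn_eq0 mk.
  move: eo; rewrite [X in orthonormal X]km_eq => eo.
  by exists e, d; split=> // i im; apply: eA; rewrite km_eq.
have ltkm : (k < m)%N by rewrite -subn_gt0 mk.
have [u [mu [uu ue uA]]] := exists_eigenvector_orthogonal As ltkm eA.
pose e1 i := if (i < k)%N then e i else u.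
pose d1 i := if (i < k)%N then d i else mu.
have [||||e' [d' [e'o e'A e'e]]] := IH k.+1 e1 d1.
- by rewrite subnS mk.
- exact: ltkm.
- move=> i j; rewrite !ltnS /e1 => ik jk.
  case: ifPn => [{}ik|]; case: ifPn => [{}jk|]; rewrite -?leqNgt.
  + exact: eo.
  + move=> kj; rewrite ue// (_ : i == j = false)//; apply/negbTE.
    by rewrite neq_ltn (leq_trans ik kj).
  + move=> ki; rewrite dotC ue// (_ : i == j = false)//; apply/negbTE.
    by rewrite neq_ltn (leq_trans jk ki) orbT.
  + move=> kj ki; rewrite uu (_ : i == j)//.
    have -> : i = k by apply/eqP; rewrite eqn_leq ik.
    by rewrite eqn_leq kj.
- by move=> i _; rewrite /e1 /d1; case: ifPn => [/eA|].
exists e', d'; split=> // i ik.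
by have [] := e'e i (ltnW ik); rewrite /e1 /d1 ik.
Qed.

End EigenExtension.

Lemma psd_congr (R : realType) k l (P : 'M[R]_(k, l)) (X : 'M[R]_l) :
  psd X -> psd (P *m X *m P^T).
Proof.
move=> [Xs Xp]; split=> [|u]; first by rewrite !trmx_mul trmxK Xs mulmxA.
by have := Xp (u *m P); rewrite trmx_mul !mulmxA.
Qed.

Section SortedHead.

Variables (T : eqType) (leT : rel T).
Hypotheses (leT_tr : transitive leT) (leT_anti : antisymmetric leT)
  (leT_total : total leT).

Lemma sorted_perm_cons x s t :
  sorted leT s -> perm_eq s (x :: t) -> all (leT x) t -> s = x :: sort leT t.
Proof.
move=> ss st xt; apply: (sorted_eq leT_tr leT_anti) => //.
  rewrite /= (path_sortedE leT_tr) sort_sorted// andbT.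
  by rewrite (perm_all _ (permEl (perm_sort _ _))).
by rewrite (perm_trans st)// perm_cons perm_sym perm_sort.
Qed.

Lemma sorted_perm_cons2 x y s t :
  sorted leT s -> perm_eq s (x :: y :: t) -> leT x y -> all (leT y) t ->
  s = x :: y :: sort leT t.
Proof.
move=> ss st xy yt; rewrite (@sorted_perm_cons x s (y :: t))//; last first.
  by rewrite /= xy; apply: sub_all yt => z; exact: leT_tr.
by congr cons; apply: sorted_perm_cons; rewrite ?sort_sorted// perm_sort.
Qed.

End SortedHead.

Section Eigenbasis.

Variables (R : realType) (m : nat) (e : nat -> 'rV[R]_m).
Hypothesis e_orthonormal : orthonormal m e.

Let P : 'M[R]_m := \matrix_(i < m) e i.

Let P_row u i : (u *m P^T) 0 i = dot u (e i).
Proof. by rewrite mxE dotE; apply: eq_bigr => k _; rewrite !mxE. Qed.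

Let PPt : P *m P^T = 1%:M.
Proof.
apply/row_matrixP => i; rewrite row_mul rowK; apply/rowP => j.
by rewrite P_row e_orthonormal// !mxE.
Qed.

Let PtP : P^T *m P = 1%:M.
Proof. exact: mulmx1C PPt. Qed.

Lemma orthonormal_sum u : u = \sum_(i < m) dot u (e i) *: e i.
Proof.
rewrite -[LHS]mulmx1 -PtP mulmxA mulmx_sum_row.
by apply: eq_bigr => i _; rewrite P_row rowK.
Qed.

Variables (M : 'M[R]_m) (c : nat -> R).
Hypothesis eM : forall i, (i < m)%N -> e i *m M = c i *: e i.

Let D : 'M[R]_m := diag_mx (\row_(i < m) c i).

Let M_conj : M = P^T *m D *m P.
Proof.
rewrite -[LHS]mul1mx -PtP -!mulmxA; congr (_ *m _).
by apply/row_matrixP => i; rewrite !row_mul row_diag_mx -scalemxAl -rowE !rowK mxE eM.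
Qed.

Lemma char_poly_eigenbasis :
  char_poly M = \prod_(x <- mkseq c m) ('X - x%:P).
Proof.
pose Q := map_mx (@polyC R) P.
have QtQ : Q^T *m Q = 1%:M by rewrite /Q map_trmx -map_mxM PtP map_mx1.
have -> : char_poly M = char_poly D.
  rewrite /char_poly /char_poly_mx M_conj !map_mxM -map_trmx -/Q.
  have QX : 'X%:M = Q^T *m 'X%:M *m Q :> 'M[{poly R}]_m.
    by rewrite mul_mx_scalar -scalemxAl QtQ scalemx1.
  by rewrite {1}QX -mulmxBl -mulmxBr !det_mulmx mulrAC -det_mulmx QtQ det1 mul1r.
rewrite char_poly_trig; last first.
  by apply: diag_mx_is_trig.
rewrite big_map /index_iota -[m in iota 0 m]subn0 -/(index_iota 0 m) big_mkord.
by apply: eq_bigr => i _; rewrite !mxE eqxx.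
Qed.

(** A sorted list of roots is determined by the characteristic polynomial, so the
    list [eigenvalues M] is the list of the diagonal values up to order. *)
Lemma eigenvalues_eigenbasis :
  sorted <=%R (eigenvalues M) /\ perm_eq (eigenvalues M) (mkseq c m).
Proof.
rewrite /eigenvalues.
case: xgetP => [s _ [ss sM]|/(_ (sort <=%R (mkseq c m)))].
  by split=> //; apply: prod_XsubC_eq; rewrite -sM char_poly_eigenbasis.
case; split; first exact: sort_le_sorted.
rewrite char_poly_eigenbasis; apply: perm_big.
by rewrite perm_sym perm_sort.
Qed.

Lemma mxtrace_eigenbasis : \tr M = \sum_(i < m) c i.
Proof.
rewrite M_conj mxtrace_mulC mulmxA PPt mul1mx mxtrace_diag.
by apply: eq_bigr => i _; rewrite mxE.
Qed.

Lemma psd_eigenbasis : psd M <-> forall i, (i < m)%N -> 0 <= c i.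
Proof.
split=> [[_ Mp] i im|c0].
  have := Mp (e i); rewrite eM// -scalemxAl mxE -/(dot _ _).
  by rewrite e_orthonormal// eqxx mulr1.
rewrite M_conj -{2}[P]trmxK; apply: psd_congr; split=> [|u].
  by rewrite tr_diag_mx.
rewrite -/(dot _ _) dotE; apply: sumr_ge0 => i _.
by rewrite mul_mx_diag !mxE mulrAC -expr2 mulr_ge0 ?sqr_ge0 ?c0.
Qed.

End Eigenbasis.

(** * Spectra of regular graphs *)

Section RegularMatrix.

Variables (R : realType) (m : nat) (M : 'M[R]_m) (r : R).
Implicit Types (s d a : R) (u : 'rV[R]_m).
Hypotheses (M_sym : M^T = M) (M_row : forall i, \sum_j M i j = r).

Lemma const_eigenvector a : const_mx a *m M = r *: const_mx a :> 'rV_m.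
Proof.
apply/rowP => j; rewrite !mxE -(M_row j) mulr_suml; apply: eq_bigr => i _.
by rewrite mxE mulrC -{1}M_sym mxE.
Qed.

(** For s = 1 and s = -1 these are the forms of the Laplacian and of the signless
    Laplacian; both are sums of squares. *)
Lemma signed_laplacian_form s u : s ^+ 2 = 1 ->
  \sum_i \sum_j M i j * (u 0 i - s * u 0 j) ^+ 2
    = 2 * (r * dot u u - s * dot (u *m M) u).
Proof.
move=> s2.
have uu : r * dot u u = \sum_i \sum_j M i j * u 0 i ^+ 2.
  rewrite dotE mulr_sumr; apply: eq_bigr => i _.
  by rewrite -(M_row i) mulr_suml; apply: eq_bigr => j _; rewrite expr2.
have uMu : s * dot (u *m M) u = \sum_i \sum_j M i j * (s * u 0 i * u 0 j).
  rewrite /dot qformE mulr_sumr; apply: eq_bigr => i _; rewrite mulr_sumr.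
  by apply: eq_bigr => j _; ring.
have uu' : r * dot u u = \sum_i \sum_j M i j * u 0 j ^+ 2.
  rewrite uu exchange_big; apply: eq_bigr => i _; apply: eq_bigr => j _.
  by rewrite -{1}M_sym mxE.
have -> : 2 * (r * dot u u - s * dot (u *m M) u)
    = r * dot u u + r * dot u u - 2 * (s * dot (u *m M) u) by ring.
rewrite {1}uu uu' uMu mulr_sumr -big_split -sumrB.
apply: eq_bigr => i _; rewrite mulr_sumr -big_split -sumrB.
apply: eq_bigr => j _ /=.
have -> : (u 0 i - s * u 0 j) ^+ 2
    = u 0 i ^+ 2 - 2 * s * u 0 i * u 0 j + s ^+ 2 * u 0 j ^+ 2 by ring.
by rewrite s2; ring.
Qed.

Hypothesis M_ge0 : forall i j, 0 <= M i j.

Lemma eigenvalue_bound d u :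
  dot u u = 1 -> u *m M = d *: u -> - r <= d <= r.
Proof.
move=> uu uM.
have bound s : s ^+ 2 = 1 -> 0 <= r - s * d.
  move=> s2; have := signed_laplacian_form u s2.
  rewrite uM dotZl uu !mulr1 => E.
  suff : 0 <= 2 * (r - s * d) by lra.
  rewrite -E; apply: sumr_ge0 => i _; apply: sumr_ge0 => j _.
  by rewrite mulr_ge0// sqr_ge0.
have := bound 1 (expr1n _ _); have := bound (- 1) (sqrr_sign _ 1).
move=> H1 H2; apply/andP; split; lra.
Qed.

(** At an eigenvector for r the Laplacian form vanishes, hence so does each of its
    squares. *)
Lemma eigenvector_locally_const u i j :
  u *m M = r *: u -> M i j != 0 -> u 0 i = u 0 j.
Proof.
move=> uM Mij; have := signed_laplacian_form u (expr1n _ 2).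
rewrite uM dotZl mul1r subrr mulr0 => /eqP.
have term_ge0 k l : 0 <= M k l * (u 0 k - 1 * u 0 l) ^+ 2.
  by rewrite mulr_ge0// sqr_ge0.
rewrite psumr_eq0 => [/allP/(_ i)|k _]; last exact: sumr_ge0.
rewrite mem_index_enum psumr_eq0//= => /(_ isT)/allP/(_ j).
rewrite mem_index_enum mulf_eq0 (negPf Mij) sqrf_eq0 mul1r subr_eq0.
by move=> /(_ isT)/eqP.
Qed.

End RegularMatrix.

Section GraphVectors.

Variables (R : realType) (T : finType).
Implicit Types (e : rel T) (f g : T -> R).

Definition fun_row f : 'rV[R]_#|T| := \row_i f (enum_val i).

Lemma sum_enum_val f : \sum_(i < #|T|) f (enum_val i) = \sum_x f x.
Proof. by rewrite -(big_enum_val (fun x => f x)). Qed.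

Lemma dot_fun_row f g : dot (fun_row f) (fun_row g) = \sum_x f x * g x.
Proof.
by rewrite dotE -sum_enum_val; apply: eq_bigr => i _; rewrite !mxE.
Qed.

Lemma fun_row_adj f e :
  fun_row f *m adj_mx R e = fun_row (fun y => \sum_x f x * (e x y)%:R).
Proof.
apply/rowP => j; rewrite !mxE -sum_enum_val; apply: eq_bigr => i _.
by rewrite !mxE.
Qed.

Lemma degree_sum e x : (degree e x)%:R = \sum_y (e x y)%:R :> R.
Proof.
rewrite /degree -sum1_card natr_sum big_mkcond; apply: eq_bigr => y _.
by rewrite inE; case: (e x y).
Qed.

Lemma regular_adj_row e r i :
  regular e r -> \sum_j adj_mx R e i j = r%:R.
Proof.
move=> er; rewrite -(er (enum_val i)) degree_sum -sum_enum_val.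
by apply: eq_bigr => j _; rewrite mxE.
Qed.

Lemma adj_mx_ge0 e i j : 0 <= adj_mx R e i j.
Proof. by rewrite mxE ler0n. Qed.

Lemma component_eigenvector e r x :
  symmetric e -> regular e r ->
  fun_row (fun y => (connect e x y)%:R) *m adj_mx R e
    = r%:R *: fun_row (fun y => (connect e x y)%:R).
Proof.
move=> es er; rewrite fun_row_adj; apply/rowP => j; rewrite !mxE.
move: (enum_val j) => y; rewrite -(er y) degree_sum mulr_suml.
apply: eq_bigr => z _; rewrite mulrC es; case: (boolP (e y z)) => [yz|_].
  rewrite !mul1r; by rewrite (same_connect_r (sym_connect_sym es) (connect1 yz)).
by rewrite !mul0r.
Qed.

Lemma connected_eigenvector_const e r (u : 'rV[R]_#|T|) :
  symmetric e -> regular e r -> connected e ->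
  u *m adj_mx R e = r%:R *: u -> forall i j, u 0 i = u 0 j.
Proof.
move=> es er ec uA i j.
have step x y : e x y -> u 0 (enum_rank x) = u 0 (enum_rank y).
  move=> xy; apply: (eigenvector_locally_const (adj_mx_sym R es)) uA _.
  - by move=> k; exact: regular_adj_row.
  - exact: adj_mx_ge0.
  - by rewrite mxE !enum_rankK xy oner_eq0.
have walk x p : path e x p -> u 0 (enum_rank x) = u 0 (enum_rank (last x p)).
  elim: p x => [//|y p IH] x /= /andP[xy yp].
  by rewrite (step _ _ xy) IH.
have [p ip jE] := connectP (ec (enum_val i) (enum_val j)).
by have := walk _ _ ip; rewrite -jE !enum_valK.
Qed.

End GraphVectors.

(** * Extreme entries of a sorted spectrum *)

Section Second.

Variables (R : realType) (m : nat).
Implicit Types (s : seq R) (d : nat -> R).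

Lemma mkseq_perm_cons2 d j : (0 < j < m)%N ->
  perm_eq (mkseq d m) (d 0%N :: d j :: [seq d i | i <- rem j (iota 1 m.-1)]).
Proof.
case: m => [|m'] /= /andP[j0 jm]; first by [].
rewrite /mkseq /= perm_cons -/(map d (j :: _)); apply: perm_map.
by apply: perm_to_rem; rewrite mem_iota j0 add1n.
Qed.

(** Stated for an arbitrary total order: the usual order gives the second smallest
    eigenvalue, and the reverse order the second largest. *)
Lemma second_of_sorted (leT : rel R) s d j :
  transitive leT -> antisymmetric leT -> total leT ->
  sorted leT s -> perm_eq s (mkseq d m) -> (0 < j < m)%N ->
  leT (d 0%N) (d j) ->
  (forall i, (0 < i < m)%N -> leT (d j) (d i)) -> s`_1 = d j.
Proof.
move=> tr anti tot ss sd jm d0j dj.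
have sd2 := perm_trans sd (mkseq_perm_cons2 d jm).
rewrite (sorted_perm_cons2 tr anti tot ss sd2)//.
have m_gt0 : (0 < m)%N by move: jm => /andP[_]; exact: leq_trans.
apply/allP => x /mapP[i /mem_rem].
by rewrite mem_iota add1n prednK// => im ->; exact: dj.
Qed.

Lemma last_of_sorted s d j :
  sorted <=%R s -> perm_eq s (mkseq d m) -> (j < m)%N ->
  (forall i, (i < m)%N -> d i <= d j) -> s`_m.-1 = d j.
Proof.
move=> ss sd jm dj.
have sz : size s = m by rewrite (perm_size sd) size_mkseq.
have m0 : (0 < m)%N by exact: leq_trans jm.
have smem x : x \in s -> exists2 i, (i < m)%N & x = d i.
  by rewrite (perm_mem sd) => /mapP[i]; rewrite mem_iota => im ->; exists i.
apply/eqP; rewrite eq_le; apply/andP; split.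
  have [|i im ->] := smem s`_m.-1; last exact: dj.
  by rewrite mem_nth// sz prednK.
have : d j \in s by rewrite (perm_mem sd); apply/mapP; exists j; rewrite ?mem_iota.
move=> /(nthP 0)[i]; rewrite sz => im <-.
apply: (sorted_leq_nth le_trans lexx) => //; rewrite ?inE ?sz ?prednK//.
by rewrite -ltnS prednK.
Qed.

End Second.

(** * The matrices of a regular bipartite graph *)

Section BipRegular.

Variables (R : realType) (V1 V2 : finType).

Local Notation T := (V1 + V2)%type.
Local Notation C := (C_mx R V1 V2).

Definition side_sign (x : T) : R := if x is inl _ then 1 else - 1.

Definition ones : 'rV[R]_#|{: T}| := const_mx 1.

Definition signs : 'rV[R]_#|{: T}| := fun_row side_sign.

Let onesE : ones = fun_row (fun=> 1).
Proof. by apply/rowP => i; rewrite !mxE. Qed.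

Lemma mulmx_outer m (u v : 'rV[R]_m) : u *m (v^T *m v) = dot u v *: v.
Proof. by rewrite mulmxA [u *m v^T]mx11_scalar mul_scalar_mx. Qed.

Lemma outerE m (v : 'rV[R]_m) i j : (v^T *m v) i j = v 0 i * v 0 j.
Proof. by rewrite mxE big_ord1 mxE. Qed.

Lemma C_mx_outer : C = 4^-1 *: (ones^T *m ones - signs^T *m signs).
Proof.
apply/matrixP => i j.
rewrite /C_mx mxE [in RHS]mxE [in RHS]mxE [X in _ + X]mxE !outerE !mxE.
case: (enum_val i) => x; case: (enum_val j) => y /=;
  by field.
Qed.

Lemma adj_bip_compl (E : V1 -> V2 -> bool) :
  adj_mx R (bip_rel (bip_compl E)) = 2 *: C - adj_mx R (bip_rel E).
Proof.
apply/matrixP => i j; rewrite !mxE.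
rewrite /bip_compl; case: (enum_val i) => x; case: (enum_val j) => y /=.
- by field.
- by case: (E x y) => /=; field.
- by case: (E y x) => /=; field.
- by field.
Qed.

Variable n : nat.
Hypotheses (n_gt0 : (0 < n)%N) (cV1 : #|V1| = n) (cV2 : #|V2| = n).

Lemma card_double : #|{: T}| = n.*2.
Proof. by rewrite card_sum cV1 cV2 addnn. Qed.

Lemma dot_ones_ones : dot ones ones = n%:R * 2.
Proof.
rewrite onesE dot_fun_row; under eq_bigr do rewrite mulr1.
by rewrite sumr_const cardT -cardE card_double -mul2n natrM mulrC.
Qed.

Lemma dot_signs_signs : dot signs signs = n%:R * 2.
Proof.
rewrite -dot_ones_ones onesE !dot_fun_row; apply: eq_bigr => -[x|x] _ //=.
by rewrite mulrNN.
Qed.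

Lemma dot_ones_signs : dot ones signs = 0.
Proof.
rewrite onesE dot_fun_row big_sumType /=.
by rewrite !sumr_const !mul1r !cardT -!cardE cV1 cV2 mulNrn subrr.
Qed.

Variables (E : V1 -> V2 -> bool) (r : nat).
Hypothesis E_reg : regular (bip_rel E) r.

Local Notation A := (adj_mx R (bip_rel E)).

Lemma A_sym : A^T = A.
Proof. by apply: adj_mx_sym; exact: bip_rel_sym. Qed.

Lemma A_row i : \sum_j A i j = r%:R.
Proof. exact: regular_adj_row. Qed.

Lemma ones_eigenvector : ones *m A = r%:R *: ones.
Proof. exact: const_eigenvector A_sym A_row _. Qed.

Lemma signs_eigenvector : signs *m A = - r%:R *: signs.
Proof.
rewrite fun_row_adj; apply/rowP => j; rewrite !mxE; move: (enum_val j) => y.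
rewrite -(E_reg y) degree_sum mulNr mulr_suml -sumrN.
by apply: eq_bigr => -[x|x] _; case: y => y /=; rewrite ?mulr0 ?mul0r ?oppr0//; lra.
Qed.

Lemma laplacian_compl :
  laplacian_mx R (graph_compl (bip_rel E))
    = (n%:R * 2 - r%:R)%:M - ones^T *m ones + A.
Proof.
have deg x : (degree (graph_compl (bip_rel E)) x)%:R = n%:R * 2 - 1 - r%:R :> R.
  rewrite degree_sum -(E_reg x) degree_sum -dot_ones_ones onesE dot_fun_row.
  have one_sum : \sum_(y : T) (x == y)%:R = 1 :> R.
    rewrite (bigD1 x)//= eqxx big1 ?addr0// => y.
    by rewrite eq_sym => /negPf ->.
  rewrite -[X in _ = _ - X - _]one_sum -!sumrB; apply: eq_bigr => y _.
  rewrite /graph_compl; case: (eqVneq x y) => [<-|_].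
    have -> : bip_rel E x x = false by case: (x).
    by rewrite /=; lra.
  by case: bip_rel => /=; lra.
apply/matrixP => i j.
rewrite /laplacian_mx mxE [X in _ = X]mxE [X in _ = X + _]mxE [X in _ = _ + X + _]mxE.
rewrite outerE !mxE deg /graph_compl (inj_eq enum_val_inj).
case: (eqVneq i j) => [->|_].
  by case: (enum_val j) => x /=; rewrite !mulr1n; lra.
by case: bip_rel; rewrite !mulr0n /=; lra.
Qed.

End BipRegular.

(** * The common eigenbasis and the closed forms *)

Section BipSpectrum.

Variables (R : realType) (V1 V2 : finType) (n : nat).
Hypotheses (n_gt0 : (0 < n)%N) (cV1 : #|V1| = n) (cV2 : #|V2| = n).
Variables (E : V1 -> V2 -> bool) (r : nat).
Hypothesis E_reg : regular (bip_rel E) r.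

Local Notation T := (V1 + V2)%type.
Local Notation m := #|{: T}|.
Local Notation A := (adj_mx R (bip_rel E)).
Local Notation C := (C_mx R V1 V2).
Local Notation L := (laplacian_mx R (graph_compl (bip_rel E))).
Local Notation ones := (ones R V1 V2).
Local Notation signs := (signs R V1 V2).

(** The scalar k is there because [ones] and [signs] have squared norm 2n. *)
Definition bip_eigenbasis (e : nat -> 'rV[R]_m) (d : nat -> R) : Prop :=
  [/\ orthonormal m e, forall i, (i < m)%N -> e i *m A = d i *: e i,
      d 0%N = r%:R, d 1%N = - r%:R &
      exists2 k, k != 0 & e 0%N = k *: ones /\ e 1%N = k *: signs].

Lemma card_gt1 : (1 < m)%N.
Proof. by rewrite (card_double cV1 cV2) -addnn; case: n n_gt0 => // k _; rewrite addnS. Qed.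

Lemma bip_eigenbasis_exists : exists e d, bip_eigenbasis e d.
Proof.
pose k : R := (Num.sqrt (n%:R * 2))^-1.
have n2 : 0 < n%:R * 2 :> R by rewrite mulr_gt0// ltr0n.
have kk : k * (k * (n%:R * 2)) = 1.
  by rewrite mulrA /k -invfM -expr2 sqr_sqrtr ?ltW// mulVf// gt_eqF.
pose e i := if i == 0%N then k *: ones else k *: signs.
pose d i : R := if i == 0%N then r%:R else - r%:R.
have [||e' [d' [e'o e'A e'e]]] :=
  @orthonormal_eigen_extend R m A 2 e d (A_sym R E) card_gt1.
- by move=> [|[|//]] [|[|//]] _ _; rewrite /e /= dotZl dotZr
    ?(dot_ones_ones R cV1 cV2) ?(dot_signs_signs R cV1 cV2) ?kk//
    1?[dot signs _]dotC (dot_ones_signs R cV1 cV2) !mulr0.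
- move=> [|[|//]] _; rewrite /e /d /= -scalemxAl.
    by rewrite (ones_eigenvector R E_reg) !scalerA mulrC.
  by rewrite (signs_eigenvector R E_reg) !scalerA mulrC.
exists e', d'; have [e0 d0] := e'e 0%N isT; have [e1 d1] := e'e 1%N isT.
split=> //; exists k => //.
by rewrite invr_eq0 gt_eqF// sqrtr_gt0.
Qed.

Variables (e : nat -> 'rV[R]_m) (d : nat -> R).
Hypothesis ed : bip_eigenbasis e d.

Let eo : orthonormal m e. Proof. by case: ed. Qed.

Let m_gt0 : (0 < m)%N. Proof. exact: ltnW card_gt1. Qed.

Lemma ones_outer_eigen i : (i < m)%N ->
  e i *m (ones^T *m ones) = (n%:R * 2 *+ (i == 0%N)) *: e i.
Proof.
move=> im; case: ed => _ _ _ _ [k k0 [e0 _]]; rewrite mulmx_outer.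
case: i im => [|i] im.
  by rewrite e0 dotZl (dot_ones_ones R cV1 cV2) scalerA mulrC.
rewrite (_ : dot _ _ = 0) ?scale0r//.
by apply: (mulfI k0); rewrite -dotZr -e0 eo// mulr0.
Qed.

Lemma signs_outer_eigen i : (i < m)%N ->
  e i *m (signs^T *m signs) = (n%:R * 2 *+ (i == 1%N)) *: e i.
Proof.
move=> im; case: ed => _ _ _ _ [k k0 [_ e1]]; rewrite mulmx_outer.
have [i1|i1] := eqVneq i 1%N.
  by rewrite i1 e1 dotZl (dot_signs_signs R cV1 cV2) scalerA mulrC.
rewrite (_ : dot _ _ = 0) ?scale0r//.
by apply: (mulfI k0); rewrite -dotZr -e1 eo ?card_gt1// (negPf i1) mulr0.
Qed.

Definition C_eigen (i : nat) : R := n%:R / 2 * ((i == 0%N)%:R - (i == 1%N)%:R).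

Lemma C_mx_eigen i : (i < m)%N -> e i *m C = C_eigen i *: e i.
Proof.
move=> im; rewrite C_mx_outer -scalemxAr mulmxBr.
rewrite ones_outer_eigen// signs_outer_eigen// -scalerBl scalerA.
congr (_ *: _); rewrite /C_eigen.
by case: i im => [|[|i]] _ /=; field.
Qed.

Lemma hhat_pencil_eigen l t i : (i < m)%N ->
  e i *m (l%:M + t *: adj_mx R (bip_rel (bip_compl E)) - C)
    = (l + t * (2 * C_eigen i - d i) - C_eigen i) *: e i.
Proof.
move=> im; case: ed => _ eA _ _ _.
rewrite adj_bip_compl mulmxBr mulmxDr mul_mx_scalar -scalemxAr mulmxBr.
rewrite -scalemxAr C_mx_eigen// eA// scalerA -scalerBl scalerA.
by rewrite -scalerDl -scalerBl.
Qed.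

Definition L_eigen (i : nat) : R := n%:R * 2 - r%:R - n%:R * 2 *+ (i == 0%N) + d i.

Lemma laplacian_eigen i : (i < m)%N -> e i *m L = L_eigen i *: e i.
Proof.
move=> im; case: ed => _ eA _ _ _.
rewrite (laplacian_compl R cV1 cV2 E_reg) mulmxDr mulmxBr mul_mx_scalar.
by rewrite ones_outer_eigen// eA// -scalerBl -scalerDl.
Qed.

Lemma d_bound i : (i < m)%N -> - r%:R <= d i <= r%:R.
Proof.
move=> im; case: ed => _ eA _ _ _.
apply: (eigenvalue_bound (A_sym R E) (A_row R E_reg) _ _ (eA _ im)).
  exact: adj_mx_ge0.
by rewrite eo// eqxx.
Qed.

Local Notation lambda2 := (second_largest_eigenvalue A).

(** The eigenvalue d_0 = r is a largest one, so the second largest entry of the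
    sorted spectrum is the maximum over the other indices. *)
Lemma lambda2_max : exists j,
  [/\ (0 < j < m)%N, lambda2 = d j & forall i, (0 < i < m)%N -> d i <= lambda2].
Proof.
case: (ed) => _ eA d0 _ _.
have [j j0 jmax] : exists2 j : 'I_m, (0 < j)%N &
    forall i : 'I_m, (0 < i)%N -> d i <= d j.
  have := @arg_maxP _ R 'I_m (Ordinal card_gt1) (fun i => 0 < i)%N (fun i => d i).
  by move=> /(_ isT) [j j0 jmax]; exists j.
have jm : (0 < j < m)%N by rewrite j0 ltn_ord.
have dmax i : (0 < i < m)%N -> d i <= d j.
  by move=> /andP[i0 im]; exact: (jmax (Ordinal im)).
suff lE : lambda2 = d j by exists j; split=> // i; rewrite lE; exact: dmax.
have [ss sp] := eigenvalues_eigenbasis eo eA.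
rewrite /second_largest_eigenvalue.
apply: (@second_of_sorted R m >=%R) => //.
- by move=> x y z xy yz; exact: le_trans yz xy.
- by move=> x y; rewrite andbC => /le_anti.
- by rewrite rev_sorted; exact: ss.
- by rewrite perm_rev.
- by rewrite d0; case/andP: (d_bound (ltn_ord j)).
Qed.

Lemma lambda2_le : lambda2 <= r%:R.
Proof.
by have [j [/andP[_ jm] -> _]] := lambda2_max; case/andP: (d_bound jm).
Qed.

Lemma lambda2_ge : - r%:R <= lambda2.
Proof.
by have [j [/andP[_ jm] -> _]] := lambda2_max; case/andP: (d_bound jm).
Qed.

Lemma sum_d : \sum_(2 <= i < m) d i = 0.
Proof.
case: (ed) => _ eA d0 d1 _.
have := mxtrace_eigenbasis eo eA.
rewrite /mxtrace big1 => [|i _]; last by rewrite mxE; case: enum_val.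
rewrite -(big_mkord predT) (big_ltn m_gt0) (big_ltn card_gt1) d0 d1; lra.
Qed.

(** With a single vertex on each side the spectrum is r, -r. *)
Lemma lambda2_single : n = 1%N -> lambda2 = - r%:R.
Proof.
move=> n1; have [j [/andP[j0 jm] -> _]] := lambda2_max.
have m2 : m = 2 by rewrite (card_double cV1 cV2) n1.
have -> : j = 1%N by case: j j0 jm => [|[|j]] // _; rewrite m2.
by case: ed.
Qed.

Lemma card_gt2 : (1 < n)%N -> (2 < m)%N.
Proof. by move=> n1; rewrite (card_double cV1 cV2) -addnn (leq_add n1 n_gt0). Qed.

(** The eigenvalues other than r and -r sum to the trace 0, so they cannot all be
    negative. *)
Lemma lambda2_ge0 : (1 < n)%N -> 0 <= lambda2.
Proof.
move=> n1; have [j [_ _ dmax]] := lambda2_max.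
rewrite leNgt; apply/negP => neg.
have : \sum_(2 <= i < m) d i < 0.
  rewrite (big_ltn (card_gt2 n1)) -[X in _ < X](addr0 0).
  apply: ltr_leD; first by apply: le_lt_trans neg; rewrite dmax// card_gt2.
  rewrite big_nat_cond; apply: sumr_le0 => i /andP[/andP[i2 im] _].
  by apply: le_trans (ltW neg); rewrite dmax// im (ltn_trans _ i2).
by rewrite sum_d ltxx.
Qed.

(** If the maximum is attained at the index 1, it is -r, the least possible
    value, and then every further eigenvalue equals it too. *)
Lemma lambda2_attained : (1 < n)%N -> exists j, (1 < j < m)%N /\ d j = lambda2.
Proof.
move=> n1; have [[|[|j]] [jm lE dmax]] := lambda2_max; first by [].
  exists 2%N; rewrite card_gt2//; split=> //.
  apply/eqP; rewrite eq_le dmax ?card_gt2//=.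
  case: ed => _ _ _ d1 _; rewrite lE d1.
  by case/andP: (d_bound (card_gt2 n1)).
by exists j.+2.
Qed.

(** The second singular value of the biadjacency matrix: the nontrivial part of
    the spectrum of A is empty when n = 1, and has maximum lambda2 otherwise. *)
Definition sigma2 : R := if n == 1%N then 0 else lambda2.

Lemma sigma2_ge0 : 0 <= sigma2.
Proof.
rewrite /sigma2; case: eqP => // /eqP n1; apply: lambda2_ge0.
by rewrite ltn_neqAle eq_sym n1.
Qed.

Lemma sigma2_max i : (1 < i < m)%N -> d i <= sigma2.
Proof.
move=> /andP[i1 im]; rewrite /sigma2; case: eqP => [n1|_].
  by move: im; rewrite (card_double cV1 cV2) n1 ltnNge i1.
have [_ [_ _ dmax]] := lambda2_max.
by apply: dmax; rewrite im (ltn_trans _ i1).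
Qed.

(** The semidefinite constraint read off the diagonal: the first two conditions
    come from the basis vectors along [ones] and [signs], on which C acts as n/2
    and -n/2, and the others from the vectors that C annihilates. *)
Lemma hhat_valuesP l :
  hhat_values (bip_compl E) l <->
  exists t, [/\ n%:R / 2 - t * (n%:R - r%:R) <= l,
                t * (n%:R - r%:R) - n%:R / 2 <= l &
                forall i, (1 < i < m)%N -> t * d i <= l].
Proof.
case: (ed) => _ _ d0 d1 _.
split=> [[t]|[t [H0 H1 H]]].
  move=> /(psd_eigenbasis eo (hhat_pencil_eigen l t)) lt; exists t; split.
  - by have := lt 0%N m_gt0; rewrite /C_eigen d0 /= mulr1n; lra.
  - by have := lt 1%N card_gt1; rewrite /C_eigen d1 /=; lra.
  - move=> [|[|i]] // /andP[_ im].
    by have := lt _ im; rewrite /C_eigen /=; lra.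
exists t; apply/(psd_eigenbasis eo (hhat_pencil_eigen l t)) => -[|[|i]] im.
- by rewrite /C_eigen d0 /=; lra.
- by rewrite /C_eigen d1 /=; lra.
- by have := H i.+2 im; rewrite /C_eigen /=; lra.
Qed.

Lemma degree_inl x : #|[set y | E x y]| = r.
Proof.
rewrite -(E_reg (inl x)) /degree.
rewrite -(card_imset _ (@inr_inj V1 V2)); apply: eq_card => -[y|y].
  by rewrite inE /=; apply/negbTE/imsetP => -[].
by rewrite (mem_imset _ _ (@inr_inj V1 V2)) !inE.
Qed.

Lemma regular_le : (r <= n)%N.
Proof.
have /card_gt0P[x _] : (0 < #|V1|)%N by rewrite cV1.
by rewrite -(degree_inl x) -cV2 max_card.
Qed.

Lemma regular_lt : (r < n)%N <-> ~ E =2 @complete_bip V1 V2.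
Proof.
split=> [rn Ec|Enc].
  have /card_gt0P[x _] : (0 < #|V1|)%N by rewrite cV1.
  move: rn; rewrite -(degree_inl x) -cV2 (_ : #|_| = #|V2|) ?ltnn//.
  by apply: eq_card => y; rewrite !inE Ec.
rewrite ltn_neqAle regular_le andbT; apply/eqP => rn; apply: Enc => x y.
have : [set y | E x y] == [set: V2].
  by rewrite eqEcard finset.subsetT finset.cardsT cV2 degree_inl rn leqnn.
by move=> /eqP/setP/(_ y); rewrite !inE.
Qed.

Lemma hhat_closed_form :
  hhat R (bip_compl E) = n%:R / 2 * quot sigma2 (sigma2 + n%:R - r%:R).
Proof.
have s0 := sigma2_ge0.
have rn : r%:R <= n%:R :> R by rewrite ler_nat regular_le.
have n0 : 0 < n%:R :> R by rewrite ltr0n.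
have [hin hlb] := @hhat_min R V1 V2 (bip_compl E) m_gt0.
set v := _ * _.
suff [vin vlb] : hhat_values (bip_compl E) v /\ lbound (hhat_values (bip_compl E)) v.
  by apply/eqP; rewrite eq_le hlb// vlb.
rewrite {}/v /quot.
have [den0|den_neq0] := eqVneq (sigma2 + n%:R - r%:R) 0.
  have s00 : sigma2 = 0 by lra.
  have nr : n%:R = r%:R :> R by lra.
  rewrite s00 eqxx mulr1; split.
    by apply/hhat_valuesP; exists 0; split=> [||i _]; rewrite ?mul0r; lra.
  by move=> l /hhat_valuesP[t []]; rewrite nr; lra.
rewrite andbF.
have den : 0 < sigma2 + n%:R - r%:R by rewrite lt_def den_neq0; lra.
split.
  (* The two decisive bounds, n/2 - t (n - r) and t sigma2, agree at this t. *)
  pose t := n%:R / 2 / (sigma2 + n%:R - r%:R).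
  have t0 : 0 <= t by rewrite !mulr_ge0 ?invr_ge0 ?ltW.
  have tden : t * (sigma2 + n%:R - r%:R) = n%:R / 2 by rewrite divfK.
  have -> : n%:R / 2 * (sigma2 / (sigma2 + n%:R - r%:R)) = t * sigma2.
    by rewrite /t; field.
  have ts0 : 0 <= t * sigma2 by rewrite mulr_ge0.
  apply/hhat_valuesP; exists t; split=> [||i im]; [lra|lra|].
  by rewrite ler_wpM2l// sigma2_max.
move=> l /hhat_valuesP[t [H0 H1 H]].
rewrite mulrA ler_pdivrMr//.
have tl : t * sigma2 <= l.
  rewrite /sigma2; case: eqP => [_|/eqP n1]; first by lra.
  have [|j [jm <-]] := lambda2_attained; first by rewrite ltn_neqAle eq_sym n1.
  exact: H.
(* Weighting the two bounds by sigma2 and n - r eliminates t. *)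
have : 0 <= sigma2 * (l - (n%:R / 2 - t * (n%:R - r%:R))).
  by rewrite mulr_ge0// subr_ge0.
have : 0 <= (n%:R - r%:R) * (l - t * sigma2) by rewrite mulr_ge0 ?subr_ge0.
by lra.
Qed.

Lemma phiH_closed_form :
  phiH R (graph_compl (bip_rel E))
    = n%:R * quot (lambda2 + r%:R) (2 * n%:R - r%:R + lambda2).
Proof.
have [ss sp] := eigenvalues_eigenbasis eo laplacian_eigen.
have [j [/andP[j0 jm] lE dmax]] := lambda2_max.
have n0 : 0 < n%:R :> R by rewrite ltr0n.
have rn : r%:R <= n%:R :> R by rewrite ler_nat regular_le.
case: (ed) => _ _ d0 d1 _.
have muN : (eigenvalues L)`_m.-1 = 2 * n%:R - r%:R + lambda2.
  rewrite (@last_of_sorted R m _ L_eigen j)//.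
    by rewrite lE /L_eigen gtn_eqF// mulr0n subr0 mulrC.
  move=> [|i] im; rewrite /L_eigen (gtn_eqF j0) /=.
    by have /andP[] := d_bound jm; rewrite d0 mulr1n mulr0n; lra.
  by have := dmax i.+1 im; rewrite lE; lra.
have mu2 : (eigenvalues L)`_1 = 2 * (n%:R - r%:R).
  rewrite (@second_of_sorted R m <=%R _ L_eigen 1)//.
  - by rewrite /L_eigen d1 /=; lra.
  - exact: le_trans.
  - exact: le_anti.
  - exact: card_gt1.
  - by rewrite /L_eigen d0 d1 /= mulr1n mulr0n; lra.
  - move=> [|i] // im; have /andP[] := d_bound im.
    by rewrite /L_eigen d1 /= mulr0n; lra.
rewrite /phiH mu2 muN.
have -> : m%:R / 2 = n%:R :> R by rewrite (card_double cV1 cV2) -muln2 natrM; field.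
congr (_ * _); rewrite /quot.
have := lambda2_ge; rewrite -subr_ge0 opprK => lge.
(* The denominator is the largest Laplacian eigenvalue; it vanishes only if
   lambda_2 = -r and r = n, and then the Laplacian quotient is 0 / 0 = 0. *)
have [den0|den0] := eqVneq (2 * n%:R - r%:R + lambda2) 0.
  have -> : lambda2 + r%:R = 0 by lra.
  by rewrite den0 invr0 mulr0 subr0 eqxx.
by rewrite andbF; field.
Qed.

(** If lambda_2 < r, the indicator vector of a component, an eigenvector for r, is
    orthogonal to all basis vectors but the first and is therefore constant.
    Conversely, in a connected graph an eigenvector for r is constant, so none is
    orthogonal to [ones]. *)
Lemma lambda2_lt_connected : lambda2 < r%:R <-> connected (bip_rel E).
Proof.
case: (ed) => _ eA _ _ [k k0 [e0 _]].
have [j [/andP[j0 jm] lE dmax]] := lambda2_max.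
split=> [ltr x y|Econn].
  pose w : 'rV[R]_m := fun_row (fun z => (connect (bip_rel E) x z)%:R).
  have wA : w *m A = r%:R *: w.
    by apply: component_eigenvector => //; exact: bip_rel_sym.
  have w_orth i : (0 < i < m)%N -> dot w (e i) = 0.
    move=> im; have /andP[_ im'] := im.
    have : (r%:R - d i) * dot w (e i) = 0.
      by rewrite mulrBl -dotZl -wA (dot_mulmx_sym _ _ (A_sym R E)) eA// dotZr subrr.
    move/eqP; rewrite mulf_eq0 subr_eq0 => /orP[/eqP ri|/eqP//].
    by have := dmax i im; rewrite -ri leNgt ltr.
  have wE : w = dot w (e 0%N) * k *: ones.
    rewrite [LHS](orthonormal_sum eo) (bigD1 (Ordinal m_gt0))//= big1 => [|i i0].
      by rewrite addr0 e0 scalerA -e0.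
    by rewrite w_orth ?scale0r// ltn_ord andbT lt0n.
  have : w 0 (enum_rank y) = w 0 (enum_rank x) by rewrite wE !mxE.
  rewrite !mxE !enum_rankK connect0.
  by case: connect => // /eqP; rewrite eq_sym oner_eq0.
rewrite lt_neqAle lambda2_le andbT; apply/eqP => lr.
have ejA : e j *m A = r%:R *: e j by rewrite eA// -lE lr.
have ej_const := connected_eigenvector_const (bip_rel_sym E) E_reg Econn ejA.
have ejE : e j = e j 0 (Ordinal m_gt0) *: ones.
  by apply/rowP => i; rewrite !mxE mulr1.
have /eqP := eo m_gt0 jm.
rewrite ltn_eqF//= ejE e0 dotZl dotZr (dot_ones_ones R cV1 cV2).
rewrite !mulf_eq0 (negPf k0) !pnatr_eq0 (gtn_eqF n_gt0) /= !orbF.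
move=> /eqP ej0; have := eo jm jm.
rewrite ejE ej0 scale0r /dot mul0mx mxE eqxx => /eqP.
by rewrite eq_sym oner_eq0.
Qed.

End BipSpectrum.

(** * Two copies of G inside the double of its complement *)

Section Transport.

Variables (R : realType) (T S : finType) (f : T -> S).

(** The 0/1 matrix of f: conjugating by it restricts a matrix along f, and
    conjugating by its transpose extends a matrix by zero along f. *)
Definition incidence_mx : 'M[R]_(#|T|, #|S|) :=
  rowsub (fun i => enum_rank (f (enum_val i))) 1%:M.

Local Notation P := incidence_mx.

Lemma incidence_conjE (Y : 'M[R]_#|S|) x y :
  (P *m Y *m P^T) (enum_rank x) (enum_rank y)
    = Y (enum_rank (f x)) (enum_rank (f y)).
Proof.
rewrite /P mul_rowsub_mx mul1mx -[_ *m _]trmxK trmx_mul trmxK.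
by rewrite mul_rowsub_mx mul1mx !mxE !enum_rankK.
Qed.

Lemma incidence_orthonormal : injective f -> P *m P^T = 1%:M.
Proof.
move=> f_inj; rewrite -[P in P *m _]mulmx1; apply/matrixP => i j.
rewrite -(enum_valK i) -(enum_valK j) incidence_conjE !mxE.
by rewrite !(inj_eq enum_rank_inj) (inj_eq f_inj).
Qed.

Lemma incidence_trconjE (X : 'M[R]_#|T|) x y : injective f ->
  (P^T *m X *m P) (enum_rank (f x)) (enum_rank (f y))
    = X (enum_rank x) (enum_rank y).
Proof.
move=> f_inj; rewrite -incidence_conjE !mulmxA incidence_orthonormal// mul1mx.
by rewrite -mulmxA incidence_orthonormal// mulmx1.
Qed.

Lemma incidence_trconj0 (X : 'M[R]_#|T|) s t :
  (forall x, f x != s) \/ (forall x, f x != t) ->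
  (P^T *m X *m P) (enum_rank s) (enum_rank t) = 0.
Proof.
have P0 u i : (forall x, f x != u) -> P i (enum_rank u) = 0.
  by move=> fu; rewrite !mxE (inj_eq enum_rank_inj) (negPf (fu _)).
case=> f0; rewrite mxE big1// => i _; last by rewrite (P0 t)// mulr0.
by rewrite mxE big1 ?mul0r// => j _; rewrite mxE P0// mul0r.
Qed.

End Transport.

Lemma psdD (R : realType) m (X Y : 'M[R]_m) : psd X -> psd Y -> psd (X + Y).
Proof.
move=> [Xs Xp] [Ys Yp]; split=> [|u]; first by rewrite linearD /= Xs Ys.
by rewrite mulmxDr mulmxDl mxE addr_ge0.
Qed.

Lemma mxtrace_sumType (R : realType) (W1 W2 : finType)
    (X : 'M[R]_#|{: W1 + W2}|) :
  \tr X = \sum_(i : W1) X (enum_rank (inl i : W1 + W2)%type) (enum_rank (inl i : W1 + W2)%type)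
        + \sum_(j : W2) X (enum_rank (inr j : W1 + W2)%type) (enum_rank (inr j : W1 + W2)%type).
Proof.
transitivity (\sum_(x : W1 + W2) X (enum_rank x) (enum_rank x)).
  by rewrite -sum_enum_val; apply: eq_bigr => i _; rewrite enum_valK.
by rewrite big_sumType.
Qed.

Lemma objectiveE (R : realType) (W1 W2 : finType)
    (X : 'M[R]_#|{: W1 + W2}|) : X^T = X ->
  \tr (C_mx R W1 W2 *m X)
    = \sum_(i : W1) \sum_(j : W2)
        X (enum_rank (inl i : W1 + W2)%type) (enum_rank (inr j : W1 + W2)%type).
Proof.
move=> Xs.
have XC x y : X (enum_rank x) (enum_rank y) = X (enum_rank y) (enum_rank x).
  by rewrite -{1}Xs mxE.
have CX (x : W1 + W2) : (C_mx R W1 W2 *m X) (enum_rank x) (enum_rank x)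
    = 2^-1 * \sum_(y : W1 + W2) (bip_rel (@complete_bip W1 W2) x y)%:R
             * X (enum_rank x) (enum_rank y).
  rewrite -scalemxAl mxE; congr (_ * _); rewrite mxE.
  rewrite -(sum_enum_val (fun y => (bip_rel (@complete_bip W1 W2) x y)%:R
             * X (enum_rank x) (enum_rank y))).
  by apply: eq_bigr => k _; rewrite mxE enum_rankK XC enum_valK.
have CXl i : \sum_y (bip_rel (@complete_bip W1 W2) (inl i) y)%:R
      * X (enum_rank (inl i : W1 + W2)%type) (enum_rank y)
    = \sum_j X (enum_rank (inl i : W1 + W2)%type) (enum_rank (inr j : W1 + W2)%type).
  rewrite big_sumType /= big1 ?add0r => [|k _]; last by rewrite mul0r.
  by apply: eq_bigr => j _; rewrite mul1r.
have CXr j : \sum_y (bip_rel (@complete_bip W1 W2) (inr j) y)%:R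
      * X (enum_rank (inr j : W1 + W2)%type) (enum_rank y)
    = \sum_i X (enum_rank (inl i : W1 + W2)%type) (enum_rank (inr j : W1 + W2)%type).
  rewrite big_sumType /= addrC big1 ?add0r => [|k _]; last by rewrite mul0r.
  by apply: eq_bigr => i _; rewrite mul1r XC.
rewrite mxtrace_sumType.
under eq_bigr do rewrite CX CXl.
under [X in _ + X]eq_bigr do rewrite CX CXr.
rewrite -!mulr_sumr [X in _ + _ * X]exchange_big /= -mulrDl.
by rewrite (_ : 2^-1 + 2^-1 = 1) ?mul1r//; field.
Qed.

Section Double.

Variables (R : realType) (V1 V2 : finType) (E : V1 -> V2 -> bool).

Local Notation T := (V1 + V2)%type.

Lemma B0_compl (x y : T) : B0 (graph_compl (bip_rel E)) x y = ~~ bip_rel E x y.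
Proof.
rewrite /B0 /graph_compl; case: eqVneq => [<-|]//=.
by case: x.
Qed.

Definition copy_left (x : T) : T + T := if x is inl _ then inl x else inr x.

Definition copy_right (x : T) : T + T := if x is inl _ then inr x else inl x.

Lemma copy_left_inj : injective copy_left.
Proof. by move=> [x|x] [y|y] //= []->. Qed.

(** From left to right the witness is the sum of the restrictions to the two
    copies, from right to left the extension by zero from the left copy. *)
Lemma h1_values_double :
  h1_values (B0 (graph_compl (bip_rel E))) = h1_values (bip_compl E) :> set R.
Proof.
apply/seteqP; split=> v [].
  move=> Y [[Ys Yp] Yt Y0] <-.
  pose P f := incidence_mx R (f : T -> T + T).
  pose X := P copy_left *m Y *m (P copy_left)^T
    + P copy_right *m Y *m (P copy_right)^T.
  have XE x y : X (enum_rank x) (enum_rank y)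
      = Y (enum_rank (copy_left x)) (enum_rank (copy_left y))
        + Y (enum_rank (copy_right x)) (enum_rank (copy_right y)).
    by rewrite mxE !incidence_conjE.
  have Xpsd : psd X by apply: psdD; exact: psd_congr.
  exists X.
    split=> //.
      rewrite -Yt !mxtrace_sumType !big_sumType /=.
      under eq_bigr do rewrite XE /=.
      under [X in _ + X]eq_bigr do rewrite XE /=.
      by rewrite !big_split /=; ring.
    move=> x y xy; rewrite XE !Y0 ?addr0//;
      by case: x y xy => x [y|y] //= xy; rewrite B0_compl /= ?xy.
  rewrite !objectiveE//; last by case: Xpsd.
  rewrite [RHS]big_sumType /=.
  under [X in _ = X + _]eq_bigr do rewrite big_sumType /=.
  under [X in _ = _ + X]eq_bigr do rewrite big_sumType /=.
  rewrite !big_split /=.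
  rewrite [X in _ = X + _ + _]big1 => [|i _]; last first.
    by rewrite big1 // => j _; rewrite Y0//= B0_compl.
  rewrite [X in _ = _ + (_ + X)]big1 => [|i _]; last first.
    by rewrite big1 // => j _; rewrite Y0//= B0_compl.
  rewrite add0r addr0 [X in _ = _ + X]exchange_big -big_split /=.
  apply: eq_bigr => i _; rewrite -big_split /=; apply: eq_bigr => j _.
  rewrite XE /=; congr (_ + _).
  by rewrite -{1}Ys mxE.
move=> X [[Xs Xp] Xt X0] <-.
pose P := incidence_mx R copy_left.
pose Y := P^T *m X *m P.
have Ypsd : psd Y.
  by rewrite /Y -{2}[P]trmxK; apply: psd_congr.
exists Y.
  split=> //.
    by rewrite /Y mxtrace_mulC mulmxA incidence_orthonormal ?mul1mx//; exact: copy_left_inj.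
  have nonleft x y : bip_rel (B0 (graph_compl (bip_rel E))) (inl x) (inr y) ->
      Y (enum_rank (inl x : T + T)%type) (enum_rank (inr y : T + T)%type) = 0.
    rewrite /= B0_compl; case: x y => x [y|y] /= xy.
    - by apply: incidence_trconj0; right=> -[z|z].
    - rewrite (@incidence_trconjE R _ _ copy_left X (inl x) (inr y) copy_left_inj).
      exact: X0.
    - by apply: incidence_trconj0; left=> -[z|z].
    - by apply: incidence_trconj0; left=> -[z|z].
  move=> [x|x] [y|y] // xy; first exact: nonleft.
  by case: Ypsd => <- _; rewrite mxE nonleft.
rewrite !objectiveE//; last by case: Ypsd.
rewrite [LHS]big_sumType /= [X in _ + X]big1 => [|i _]; last first.
  by rewrite big1// => j _; apply: incidence_trconj0; left=> -[z|z].
rewrite addr0; apply: eq_bigr => i _; rewrite big_sumType /= big1 => [|j _]; last first.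
  by apply: incidence_trconj0; right=> -[z|z].
rewrite add0r; apply: eq_bigr => j _.
exact: (@incidence_trconjE R _ _ copy_left X (inl i) (inr j) copy_left_inj).
Qed.

End Double.

(** * Comparison of the two bounds *)

(** Away from the degenerate denominator the difference of the two sides is a
    positive multiple of (n - r) (r - s). *)
Lemma quot_compare (R : realType) (s r n : R) :
  0 <= s -> s <= r -> r <= n -> 0 < n ->
  quot s (s + n - r) <= quot (s + r) (2 * n - r + s) /\
  (quot s (s + n - r) < quot (s + r) (2 * n - r + s) <-> s < r /\ r < n).
Proof.
move=> s0 sr rn n0.
have den2 : 0 < 2 * n - r + s by lra.
have -> : quot (s + r) (2 * n - r + s) = (s + r) / (2 * n - r + s).
  by rewrite /quot (gt_eqF den2) andbF.
have [den1|den1] := eqVneq (s + n - r) 0.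
  have [-> ->] : s = 0 /\ r = n by lra.
  rewrite /quot add0r subrr eqxx (_ : n / (2 * n - n + 0) = 1).
    by rewrite /= !ltxx; split; [exact: lexx|split=> [|[]]].
  by rewrite (_ : 2 * n - n + 0 = n) ?divff ?gt_eqF//; ring.
have den1p : 0 < s + n - r by rewrite lt_def den1; lra.
rewrite /quot (negPf den1) andbF.
have gap : (s + r) / (2 * n - r + s) - s / (s + n - r)
    = (n - r) * (r - s) / ((2 * n - r + s) * (s + n - r)).
  by field; rewrite den1 gt_eqF.
have dd : 0 < ((2 * n - r + s) * (s + n - r))^-1 by rewrite invr_gt0 mulr_gt0.
rewrite -subr_ge0 -(subr_gt0 (s / _)) gap pmulr_lge0// pmulr_lgt0//.
split; first by rewrite mulr_ge0// subr_ge0.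
split=> [prod_gt0|[sr' rn']]; last by rewrite mulr_gt0 ?subr_gt0.
split; rewrite lt_neqAle ?sr ?rn andbT; apply/eqP => eq; move: prod_gt0;
  by rewrite eq subrr ?mulr0 ?mul0r ltxx.
Qed.

Unset Implicit Arguments.

Theorem proposition4p10 (R : realType) (V1 V2 : finType) (E : V1 -> V2 -> bool) :
  h1 R (B0 (graph_compl (bip_rel E))) = h1 R (bip_compl E)
  /\
  (forall n r : nat,
     (0 < n)%N -> #|V1| = n -> #|V2| = n -> regular (bip_rel E) r ->
     let lambda2 := second_largest_eigenvalue (adj_mx R (bip_rel E)) in
     let phi := phiH R (graph_compl (bip_rel E)) in
     [/\ hhat R (bip_compl E)
           = n%:R / 2 * quot lambda2 (lambda2 + n%:R - r%:R),
         hhat R (bip_compl E) <= 2^-1 * phi,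
         2^-1 * phi
           = n%:R / 2 * quot (lambda2 + r%:R) (2 * n%:R - r%:R + lambda2),
         hhat R (bip_compl E) < 2^-1 * phi <-> lambda2 < r%:R /\ (r < n)%N &
         lambda2 < r%:R /\ (r < n)%N <->
           connected (bip_rel E) /\ ~ (E =2 @complete_bip V1 V2)]).
Proof.
split=> [|n r n_gt0 cV1 cV2 E_reg lambda2 phi].
  by rewrite /h1 h1_values_double.
have [e [d ed]] := bip_eigenbasis_exists R n_gt0 cV1 cV2 E_reg.
have rn : (r <= n)%N := regular_le n_gt0 cV1 cV2 E_reg.
have n0 : 0 < n%:R :> R by rewrite ltr0n.
have phiE : 2^-1 * phi
    = n%:R / 2 * quot (lambda2 + r%:R) (2 * n%:R - r%:R + lambda2).
  by rewrite /phi (phiH_closed_form n_gt0 cV1 cV2 E_reg ed) mulrA [_^-1 * _]mulrC.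
have hhatE := hhat_closed_form n_gt0 cV1 cV2 E_reg ed.
(* For n = 1 the number lambda_2 = -r is negative if r = 1, so that the comparison
   of closed forms does not apply; the two possible values of r are evaluated
   directly, with the convention 0 / 0 = 1 for r = 1. *)
have [sE [sle slt]] :
    quot (sigma2 R n E) (sigma2 R n E + n%:R - r%:R)
      = quot lambda2 (lambda2 + n%:R - r%:R) /\
    (quot lambda2 (lambda2 + n%:R - r%:R)
       <= quot (lambda2 + r%:R) (2 * n%:R - r%:R + lambda2) /\
     (quot lambda2 (lambda2 + n%:R - r%:R)
        < quot (lambda2 + r%:R) (2 * n%:R - r%:R + lambda2)
        <-> lambda2 < r%:R /\ r%:R < n%:R :> R)).
  rewrite /sigma2; case: eqP => [n1|/eqP n1].
    rewrite /lambda2 (lambda2_single n_gt0 cV1 cV2 E_reg ed n1).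
    move: rn; rewrite n1 leq_eqVlt ltnS leqn0 => /orP[]/eqP->.
      have -> : quot 0 (0 + 1%:R - 1%:R) = 1 :> R.
        by rewrite /quot add0r subrr eqxx.
      have -> : quot (- 1%:R) (- 1%:R + 1%:R - 1%:R) = 1 :> R.
        by rewrite /quot addNr add0r oppr_eq0 oner_eq0 divff// oppr_eq0 oner_eq0.
      have -> : quot (- 1%:R + 1%:R) (2 * 1%:R - 1%:R + - 1%:R) = 1 :> R.
        by rewrite /quot addNr eqxx (_ : _ + _ = 0) ?eqxx//; ring.
      by rewrite !ltxx lexx; split=> //; split=> //; split=> [|[]].
    rewrite !mulr0n oppr0 !addr0 !add0r.
    have quot0 a : a != 0 -> quot 0 a = 0 :> R.
      by move=> a0; rewrite /quot (negPf a0) andbF mul0r.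
    by rewrite !quot0 ?mulr1 ?pnatr_eq0// !ltxx lexx; split=> //; split=> //; split=> [|[]].
  split=> //; apply: quot_compare => //.
  - apply: (lambda2_ge0 n_gt0 cV1 cV2 E_reg ed).
    by rewrite ltn_neqAle eq_sym n1.
  - exact: (lambda2_le n_gt0 cV1 cV2 E_reg ed).
  - by rewrite ler_nat.
have half_gt0 : 0 < n%:R / 2 :> R by rewrite divr_gt0.
rewrite phiE hhatE sE; split=> //.
- by rewrite ler_pM2l.
- by rewrite ltr_pM2l// slt ltr_nat.
- have lc := lambda2_lt_connected n_gt0 cV1 cV2 E_reg ed.
  by have rc := regular_lt n_gt0 cV1 cV2 E_reg; rewrite /lambda2; tauto.
Qed.
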